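(* Let $X$ be a represented space, let $Y$ be a computable metric space and let $n\in\mathbb{N}$. If $f:\subseteq X\to Y$ is single-valued and weakly $(n+1)$–computable, then $f$ is $(n+1)$–computable.
   Context: Baire space $\mathbb{N}^\mathbb{N}$ is represented by the identity. A representation of a set $X$ is a surjective partial function $\delta:\subseteq\mathbb{N}^\mathbb{N}\to X$; a represented space is a pair $(X,\delta)$. For $f:\subseteq(X,\delta_X)\rightrightarrows(Y,\delta_Y)$ a realizer is a single-valued partial $F$ on Baire space with $\delta_Y(F(p))\in f(\delta_X(p))$ for all $p\in\mathrm{dom}(f\circ\delta_X)$ ($F\vdash f$). With $\langle p,q\rangle(2n)=p(n)$, $\langle p,q\rangle(2n+1)=q(n)$: $f\le_W g$ iff there are computable partial $H,K$ on Baire space such that $p\mapsto H\langle p,G(K(p))\rangle$ realizes $f$ for every $G\vdash g$. Composition: $(g\circ h)(x)=\bigcup_{y\in h(x)}g(y)$, $\mathrm{dom}(g\circ h)=\{x\in\mathrm{dom}(h):h(x)\subseteq\mathrm{dom}(g)\}$. A computable metric space is $(Y,d,\alpha)$ with $(Y,d)$ a metric space, $\alpha:\mathbb{N}\to Y$ with dense range, and $(i,j)\mapsto d(\alpha(i),\alpha(j))$ a computable double sequence of reals; it is represented by the Cauchy representation $\delta_Y(p)=\lim_m\alpha(p(m))$ for those $p$ with $d(\alpha(p(m)),\alpha(p(k)))<2^{-m}$ for all $k>m$. Let $(q_k)$ be a standard enumeration of the non-negative rationals and $B_{\langle i,k\rangle}=\{y:d(\alpha(i),y)<q_k\}$. The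 closed subsets of $Y$ are represented by $\psi_-(p)=Y\setminus\bigcup_i B_{p(i)}$; closed choice $\mathrm{C}_Y$ maps a non-empty closed set $A$ (given via $\psi_-$) to any point of $A$. $\mathrm{C}_{\{0,1\}^\mathbb{N}}$ is closed choice for Cantor space with metric $d(p,q)=2^{-\min\{i:p(i)\neq q(i)\}}$ and a standard dense sequence of eventually-zero sequences. $\lim:\subseteq\mathbb{N}^\mathbb{N}\to\mathbb{N}^\mathbb{N}$ maps $\langle p_0,p_1,\ldots\rangle$ ($\langle p_0,p_1,\ldots\rangle(\langle i,j\rangle)=p_i(j)$, standard pairing) to $\lim_i p_i$ when it exists; $\lim^{\circ m}$ is the $m$-fold composition, $\lim^{\circ 0}=\mathrm{id}$. $f$ is $(n+1)$–computable if $f\le_W\lim^{\circ n}$. $f$ is weakly $(n+1)$–computable if $f=g\circ h$ for some multi-valued functions $g,h$ on represented spaces with $g\le_W\mathrm{C}_{\{0,1\}^\mathbb{N}}$ and $h\le_W\lim^{\circ n}$. *)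

(* Defs.v *)
From Stdlib Require Import Reals Lra Lia Arith Cantor Classical.
From Stdlib Require Import ClassicalEpsilon ClassicalChoice.
From Stdlib Require Import FunctionalExtensionality PropExtensionality.
From Stdlib Require Import ProofIrrelevance.
Open Scope R_scope.

(** * Multi-valued partial functions *)

(** A multi-valued partial function is given by its graph: [f(x)] is the set
    of all [y] with [f x y], and [x] is in the domain iff [f(x)] is non-empty. *)
Definition mfun (A B : Type) : Type := A -> B -> Prop.

Definition mdom {A B : Type} (f : mfun A B) (x : A) : Prop := exists y, f x y.

Definition single_valued {A B : Type} (f : mfun A B) : Prop :=
  forall x y y', f x y -> f x y' -> y = y'.

Definition mcomp {A B C : Type} (g : mfun B C) (h : mfun A B) : mfun A C :=
  fun x z => (forall y, h x y -> mdom g y) /\ (exists y, h x y /\ g y z).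

(** * Computability on the natural numbers and on Baire space *)

Definition baire : Type := nat -> nat.

Definition npair (i j : nat) : nat := Cantor.to_nat (i, j).
Definition nfst (n : nat) : nat := fst (Cantor.of_nat n).
Definition nsnd (n : nat) : nat := snd (Cantor.of_nat n).

(** Kleene's partial recursive functions relative to an oracle; all functions
    are unary, several arguments being passed through [npair]. *)
Inductive code : Set :=
| Zero : code
| Succ : code
| Fst : code
| Snd : code
| Oracle : code
| Pair : code -> code -> code
| Comp : code -> code -> code
| Prec : code -> code -> code
| Mu : code -> code.

(** [h(m,0) = a(m)], [h(m,n+1) = b(m,(n,h(m,n)))]. *)
Fixpoint prec_graph (a b : mfun nat nat) (m n y : nat) : Prop :=
  match n with
  | O => a m y
  | S n' => exists z,
      prec_graph a b m n' z /\ b (npair m (npair n' z)) y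
  end.

(** The least [n] with [a(x,n) = 0], all previous values being defined. *)
Definition mu_graph (a : mfun nat nat) (x n : nat) : Prop :=
  a (npair x n) 0%nat /\
  forall i, (i < n)%nat -> exists k, a (npair x i) (S k).

(** [eval p c x y]: the program [c] with oracle [p] halts on input [x] with
    output [y]. *)
Fixpoint eval (p : baire) (c : code) : mfun nat nat :=
  match c with
  | Zero => fun _ y => y = 0%nat
  | Succ => fun x y => y = S x
  | Fst => fun x y => y = nfst x
  | Snd => fun x y => y = nsnd x
  | Oracle => fun x y => y = p x
  | Pair a b => fun x y =>
      exists u v, eval p a x u /\ eval p b x v /\ y = npair u v
  | Comp a b => fun x y => exists u, eval p b x u /\ eval p a u y
  | Prec a b => fun x y =>
      prec_graph (eval p a) (eval p b) (nfst x) (nsnd x) y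
  | Mu a => fun x y => mu_graph (eval p a) x y
  end.

(** Total recursive functions: the oracle is the zero sequence. *)
Definition recursive (f : nat -> nat) : Prop :=
  exists c, forall n, eval (fun _ => 0%nat) c n (f n).

(** [F] is the partial function on Baire space computed by an oracle program:
    [p] is in its domain iff the program with oracle [p] is total. *)
Definition computable (F : mfun baire baire) : Prop :=
  exists c, forall p q, F p q <-> (forall n, eval p c n (q n)).

(** Computable double sequence of reals: [x i j] is approximated with error at
    most [2^-k] by the rational [(-1)^s * a / b], with [s], [a], [b] recursive
    functions of [(i,j,k)]. *)
Definition computable_double_seq (x : nat -> nat -> R) : Prop :=
  exists s a b : nat -> nat,
    recursive s /\ recursive a /\ recursive b /\
    (forall t, b t <> 0%nat) /\
    forall i j k, let t := npair i (npair j k) in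
      Rabs (x i j - (-1) ^ (s t) * INR (a t) / INR (b t)) <= (/ 2) ^ k.

(** * Represented spaces and Weihrauch reducibility *)

Record RepSpace : Type := mkRepSpace {
  carrier :> Type;
  rep : mfun baire carrier;
  rep_single : single_valued rep;
  rep_surj : forall x, exists p, rep p x
}.

Definition realizes {X Y : RepSpace} (F : mfun baire baire) (f : mfun X Y)
  : Prop :=
  single_valued F /\
  forall p x, rep X p x -> mdom f x ->
    exists q y, F p q /\ rep Y q y /\ f x y.

Definition bpair (p q : baire) : baire := fun n =>
  if Nat.even n then p (Nat.div2 n) else q (Nat.div2 n).

Definition sandwich (H K G : mfun baire baire) : mfun baire baire :=
  fun p q => exists r s, K p r /\ G r s /\ H (bpair p s) q.

Definition weihrauch_le {X Y Z W : RepSpace} (f : mfun X Y) (g : mfun Z W)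
  : Prop :=
  exists H K, computable H /\ computable K /\
    forall G, realizes G g -> realizes (sandwich H K G) f.

Lemma baire_rep_single : single_valued (fun p x : baire => x = p).
Proof. intros p x y -> ->; reflexivity. Qed.

Lemma baire_rep_surj (x : baire) : exists p : baire, x = p.
Proof. now exists x. Qed.

Definition baire_space : RepSpace :=
  mkRepSpace baire (fun p x => x = p) baire_rep_single baire_rep_surj.

(** * Computable metric spaces *)

Record DenseMetricSpace : Type := mkDenseMetricSpace {
  msp :> Metric_Space;
  alpha : nat -> Base msp;
  alpha_dense : forall (y : Base msp) (eps : R), eps > 0 ->
    exists i, dist msp (alpha i) y < eps
}.

Record CompMetricSpace : Type := mkCompMetricSpace {
  dsp :> DenseMetricSpace;
  dist_computable :
    computable_double_seq (fun i j => dist dsp (alpha dsp i) (alpha dsp j))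
}.

Definition cauchy_rep (Y : DenseMetricSpace) : mfun baire (Base Y) :=
  fun p y =>
    (forall m k, (m < k)%nat ->
       dist Y (alpha Y (p m)) (alpha Y (p k)) < (/ 2) ^ m) /\
    (forall eps, eps > 0 ->
       exists N, forall m, (N <= m)%nat -> dist Y (alpha Y (p m)) y < eps).

Lemma cauchy_rep_single (Y : DenseMetricSpace) : single_valued (cauchy_rep Y).
Proof.
  intros p y z [_ Hy] [_ Hz].
  apply (dist_refl Y).
  destruct (Rtotal_order (dist Y y z) 0) as [H|[H|H]]; auto.
  - pose proof (dist_pos Y y z); lra.
  - destruct (Hy (dist Y y z / 2)) as [N HN]; [lra|].
    destruct (Hz (dist Y y z / 2)) as [M HM]; [lra|].
    specialize (HN (N + M)%nat ltac:(lia)).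
    specialize (HM (N + M)%nat ltac:(lia)).
    pose proof (dist_tri Y y z (alpha Y (p (N + M)%nat))) as Ht.
    rewrite (dist_sym Y y (alpha _ _)) in Ht. lra.
Qed.

Lemma half_pow_pos (m : nat) : 0 < (/ 2) ^ m.
Proof. apply pow_lt; lra. Qed.

Lemma half_pow_le (m k : nat) : (m <= k)%nat -> (/ 2) ^ k <= (/ 2) ^ m.
Proof.
  induction 1 as [|k Hk IH]; [lra|].
  simpl. pose proof (half_pow_pos k); lra.
Qed.

Lemma half_pow_small (eps : R) : eps > 0 ->
  exists N, forall m, (N <= m)%nat -> (/ 2) ^ m < eps.
Proof.
  intros He.
  destruct (pow_lt_1_zero (/ 2)) with (y := eps) as [N HN].
  - rewrite Rabs_pos_eq; lra.
  - exact He.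
  - exists N; intros m Hm.
    specialize (HN m ltac:(lia)).
    rewrite Rabs_pos_eq in HN; [exact HN|].
    pose proof (half_pow_pos m); lra.
Qed.

Lemma cauchy_rep_surj (Y : DenseMetricSpace) (y : Base Y) :
  exists p, cauchy_rep Y p y.
Proof.
  destruct (choice (fun m i => dist Y (alpha Y i) y < (/ 2) ^ (S m)))
    as [p Hp].
  { intros m. apply alpha_dense. apply half_pow_pos. }
  exists p; split.
  - intros m k Hmk.
    pose proof (Hp m) as Hm; pose proof (Hp k) as Hk.
    pose proof (dist_tri Y (alpha Y (p m)) (alpha Y (p k)) y) as Ht.
    rewrite (dist_sym Y y (alpha _ _)) in Ht.
    pose proof (half_pow_le m k ltac:(lia)). simpl in Hm, Hk. lra.
  - intros eps He. destruct (half_pow_small eps He) as [N HN].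
    exists N; intros m Hm.
    specialize (HN (S m) ltac:(lia)). specialize (Hp m). lra.
Qed.

Definition cauchy_space (Y : DenseMetricSpace) : RepSpace :=
  mkRepSpace (Base Y) (cauchy_rep Y) (cauchy_rep_single Y) (cauchy_rep_surj Y).

(** * Closed choice *)

(** Enumeration of the non-negative rationals. *)
Definition qenum (k : nat) : R := INR (nfst k) / INR (S (nsnd k)).

Definition cball (Y : DenseMetricSpace) (n : nat) (y : Base Y) : Prop :=
  dist Y (alpha Y (nfst n)) y < qenum (nsnd n).

Definition is_closed (Y : DenseMetricSpace) (A : Base Y -> Prop) : Prop :=
  forall y, ~ A y ->
    exists eps, eps > 0 /\ forall z, dist Y y z < eps -> ~ A z.

Definition closed_subset (Y : DenseMetricSpace) : Type :=
  {A : Base Y -> Prop | is_closed Y A}.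

Definition psi_minus (Y : DenseMetricSpace) : mfun baire (closed_subset Y) :=
  fun p A => forall y, proj1_sig A y <-> ~ (exists i, cball Y (p i) y).

Lemma psi_minus_single (Y : DenseMetricSpace) : single_valued (psi_minus Y).
Proof.
  intros p [A HA] [B HB] H1 H2. unfold psi_minus in *; simpl in *.
  assert (A = B) as E.
  { apply functional_extensionality; intros y.
    apply propositional_extensionality. rewrite H1, H2. tauto. }
  subst B. f_equal. apply proof_irrelevance.
Qed.

Lemma nfst_npair (i j : nat) : nfst (npair i j) = i.
Proof. unfold nfst, npair. now rewrite Cantor.cancel_of_to. Qed.

Lemma nsnd_npair (i j : nat) : nsnd (npair i j) = j.
Proof. unfold nsnd, npair. now rewrite Cantor.cancel_of_to. Qed.

Lemma psi_minus_surj (Y : DenseMetricSpace) (A : closed_subset Y) :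
  exists p, psi_minus Y p A.
Proof.
  destruct A as [A HA]. unfold psi_minus; simpl.
  destruct (choice (fun n m =>
     (forall z, cball Y m z -> ~ A z) /\
     ((forall z, cball Y n z -> ~ A z) -> m = n))) as [p Hp].
  { intros n.
    destruct (classic (forall z, cball Y n z -> ~ A z)) as [H|H].
    - exists n; auto.
    - exists (npair 0 (npair 0 0)); split; [|tauto].
      intros z Hz. exfalso. unfold cball, qenum in Hz.
      rewrite !nsnd_npair, !nfst_npair in Hz. simpl in Hz.
      pose proof (dist_pos Y (alpha Y 0%nat) z).
      unfold Rdiv in Hz. lra. }
  exists p; intros y; split.
  - intros Hy [i Hi]. exact (proj1 (Hp i) y Hi Hy).
  - intros Hn. apply NNPP; intros Hy. apply Hn.
    destruct (HA y Hy) as (eps & He & Heps).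
    destruct (half_pow_small (eps / 2)) as [N HN]; [lra|].
    specialize (HN N (le_n N)).
    destruct (alpha_dense Y y ((/ 2) ^ N) (half_pow_pos N)) as [i Hi].
    assert (Hq : qenum (npair 1 (Nat.pred (2 ^ N))) = (/ 2) ^ N).
    { unfold qenum. rewrite nfst_npair, nsnd_npair.
      assert ((2 ^ N)%nat <> 0%nat) by (apply Nat.pow_nonzero; lia).
      rewrite Nat.succ_pred by assumption.
      rewrite pow_INR, pow_inv. simpl INR.
      replace (1 + 1) with 2 by lra. lra. }
    set (n := npair i (npair 1 (Nat.pred (2 ^ N)))).
    assert (Hc : forall z, cball Y n z <->
                           dist Y (alpha Y i) z < (/ 2) ^ N).
    { intros z. unfold cball, n. rewrite nfst_npair, nsnd_npair, Hq. tauto. }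
    exists n. rewrite (proj2 (Hp n)); [now apply Hc|].
    intros z Hz. apply Hc in Hz. apply Heps.
    pose proof (dist_tri Y y z (alpha Y i)) as Ht.
    rewrite (dist_sym Y y (alpha Y i)) in Ht. lra.
Qed.

Definition closed_space (Y : DenseMetricSpace) : RepSpace :=
  mkRepSpace (closed_subset Y) (psi_minus Y)
    (psi_minus_single Y) (psi_minus_surj Y).

Definition closed_choice (Y : DenseMetricSpace)
  : mfun (closed_space Y) (cauchy_space Y) :=
  fun A y => proj1_sig A y.

(** * Cantor space *)

Definition first_diff (p q : nat -> bool) (i : nat) : Prop :=
  p i <> q i /\ forall j, (j < i)%nat -> p j = q j.

Definition cantor_dist (p q : nat -> bool) : R :=
  match excluded_middle_informative (exists i, first_diff p q i) with
  | left H => (/ 2) ^ (proj1_sig (constructive_indefinite_description _ H))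
  | right _ => 0
  end.

Lemma first_diff_unique p q i j :
  first_diff p q i -> first_diff p q j -> i = j.
Proof.
  intros [Hi Hi'] [Hj Hj'].
  destruct (lt_eq_lt_dec i j) as [[H|H]|H]; auto.
  - now specialize (Hj' i H).
  - now specialize (Hi' j H).
Qed.

Lemma first_diff_ex p q : p <> q -> exists i, first_diff p q i.
Proof.
  intros Hpq. apply NNPP; intros Hn. apply Hpq.
  apply functional_extensionality; intros i.
  induction i as [i IH] using lt_wf_ind.
  apply NNPP; intros Hi. apply Hn. exists i; split; auto.
Qed.

Lemma cantor_dist_first p q i :
  first_diff p q i -> cantor_dist p q = (/ 2) ^ i.
Proof.
  intros H. unfold cantor_dist.
  destruct (excluded_middle_informative _) as [E|E].
  - f_equal.
    destruct (constructive_indefinite_description _ E) as [j Hj]; simpl.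
    eapply first_diff_unique; eauto.
  - exfalso; apply E; now exists i.
Qed.

Lemma cantor_dist_same p : cantor_dist p p = 0.
Proof.
  unfold cantor_dist.
  destruct (excluded_middle_informative _) as [E|E]; [|reflexivity].
  exfalso; destruct E as [i [Hi _]]; congruence.
Qed.

Lemma cantor_dist_pos p q : cantor_dist p q >= 0.
Proof.
  destruct (classic (p = q)) as [->|H].
  - rewrite cantor_dist_same; lra.
  - destruct (first_diff_ex p q H) as [i Hi].
    rewrite (cantor_dist_first _ _ _ Hi).
    pose proof (half_pow_pos i); lra.
Qed.

Lemma cantor_dist_sym p q : cantor_dist p q = cantor_dist q p.
Proof.
  destruct (classic (p = q)) as [->|H]; [reflexivity|].
  destruct (first_diff_ex p q H) as [i [Hi Hi']].
  rewrite (cantor_dist_first p q i), (cantor_dist_first q p i);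
    [reflexivity | | now split].
  split; [congruence|]. intros j Hj; symmetry; auto.
Qed.

Lemma cantor_dist_refl p q : cantor_dist p q = 0 <-> p = q.
Proof.
  split; [|intros ->; apply cantor_dist_same].
  intros H. apply NNPP; intros Hpq.
  destruct (first_diff_ex p q Hpq) as [i Hi].
  rewrite (cantor_dist_first _ _ _ Hi) in H.
  pose proof (half_pow_pos i); lra.
Qed.

Lemma cantor_dist_ge p q i : p i <> q i -> (/ 2) ^ i <= cantor_dist p q.
Proof.
  intros Hi.
  destruct (first_diff_ex p q) as [j Hj]; [congruence|].
  rewrite (cantor_dist_first _ _ _ Hj).
  apply half_pow_le. destruct Hj as [_ Hj].
  destruct (le_lt_dec j i) as [|H]; auto. now specialize (Hj i H).
Qed.

Lemma cantor_dist_tri p q r :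
  cantor_dist p q <= cantor_dist p r + cantor_dist r q.
Proof.
  pose proof (cantor_dist_pos p r). pose proof (cantor_dist_pos r q).
  destruct (classic (p = q)) as [->|Hpq].
  { rewrite cantor_dist_same; lra. }
  destruct (first_diff_ex p q Hpq) as [i Hi].
  rewrite (cantor_dist_first _ _ _ Hi). destruct Hi as [Hi _].
  destruct (Bool.bool_dec (p i) (r i)) as [E|E].
  - pose proof (cantor_dist_ge r q i ltac:(congruence)); lra.
  - pose proof (cantor_dist_ge p r i E); lra.
Qed.

Definition cantor_metric : Metric_Space :=
  Build_Metric_Space (nat -> bool) cantor_dist cantor_dist_pos
    cantor_dist_sym cantor_dist_refl cantor_dist_tri.

(** The [i]-th eventually-zero sequence is the binary expansion of [i], least
    significant digit first. *)
Definition cantor_alpha (i : nat) : Base cantor_metric := Nat.testbit i.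

Lemma cantor_alpha_prefix (y : nat -> bool) (N : nat) :
  exists i, forall j, (j < N)%nat -> Nat.testbit i j = y j.
Proof.
  revert y; induction N as [|N IH]; intros y.
  - exists 0%nat; lia.
  - destruct (IH (fun j => y (S j))) as [i Hi].
    exists (2 * i + Nat.b2n (y 0%nat))%nat. intros [|j] Hj.
    + apply Nat.testbit_0_r.
    + rewrite Nat.testbit_succ_r. apply Hi; lia.
Qed.

Lemma cantor_alpha_dense (y : Base cantor_metric) (eps : R) : eps > 0 ->
  exists i, dist cantor_metric (cantor_alpha i) y < eps.
Proof.
  intros He. destruct (half_pow_small eps He) as [N HN].
  destruct (cantor_alpha_prefix y N) as [i Hi]. exists i.
  change (cantor_dist (Nat.testbit i) y < eps).
  destruct (classic (Nat.testbit i = y)) as [E|H].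
  - rewrite E, cantor_dist_same; lra.
  - destruct (first_diff_ex _ _ H) as [j Hj].
    rewrite (cantor_dist_first _ _ _ Hj). apply HN.
    destruct (le_lt_dec N j) as [|Hlt]; auto.
    exfalso; apply (proj1 Hj), Hi, Hlt.
Qed.

Definition cantor_space : DenseMetricSpace :=
  mkDenseMetricSpace cantor_metric cantor_alpha cantor_alpha_dense.

(** * Limits and the computability levels *)

(** [p] stands for [<p_0, p_1, ...>], with [p_i(j) = p (npair i j)]. *)
Definition lim : mfun baire_space baire_space :=
  fun p q => forall j, exists N, forall i, (N <= i)%nat ->
    p (npair i j) = q j.

Fixpoint lim_iter (m : nat) : mfun baire_space baire_space :=
  match m with
  | O => fun p q => q = p
  | S m' => mcomp lim (lim_iter m')
  end.

(** (n+1)-computability. *)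
Definition succ_computable (n : nat) {X Y : RepSpace} (f : mfun X Y) : Prop :=
  weihrauch_le f (lim_iter n).

(** Weak (n+1)-computability. *)
Definition weakly_succ_computable (n : nat) {X Y : RepSpace} (f : mfun X Y)
  : Prop :=
  exists (Z : RepSpace) (g : mfun Z Y) (h : mfun X Z),
    (forall x y, f x y <-> mcomp g h x y) /\
    weihrauch_le g (closed_choice cantor_space) /\
    weihrauch_le h (lim_iter n).

(* Main.v *)
(** Let [f = g o h], where [h] reduces to [lim^n] by [Hh], [Kh] and [g] reduces
    to closed choice on Cantor space by [Hg], [Kg].  From the answer of [lim^n]
    one computes a name [t] of a point of [h x] and the name [r = Kg t] of a
    non-empty closed set [A] of Cantor space.  For every [a] in [A], [Hg] maps
    [<t, a>] to a name of a point of [g (h x)], and as [f] is single-valued this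
    point is always [y = f x].  Hence [y] is computable from [t]: for precision
    [k], search for a length [N] and a dense point [m] such that each binary word
    of length [N] is either seen to lie outside [A], or makes [Hg] produce (within
    [N] search steps and reading only that word) an approximation close to [m].
    By compactness the search ends; as [A] is non-empty, one of the
    approximations is correct, so [m] is close to [y]. *)

From Stdlib Require Import Reals Lra Lia Arith Bool.
From Stdlib Require Import ClassicalEpsilon FunctionalExtensionality.
Require Import Defs.
Local Open Scope nat_scope.

(** * Determinism of programs and substitution for the oracle *)

Lemma npair_eta (x : nat) : npair (nfst x) (nsnd x) = x.
Proof.
  unfold npair, nfst, nsnd. rewrite <- surjective_pairing.
  apply Cantor.cancel_to_of.
Qed.

Lemma eval_single (p : baire) (c : code) : single_valued (eval p c).
Proof.
  induction c as [| | | | |a IHa b IHb|a IHa b IHb|a IHa b IHb|a IHa];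
    intros x y y'; cbn.
  1-5: congruence.
  - intros (u & v & Hu & Hv & ->) (u' & v' & Hu' & Hv' & ->).
    now rewrite (IHa _ _ _ Hu Hu'), (IHb _ _ _ Hv Hv').
  - intros (u & Hu & Hy) (u' & Hu' & Hy').
    rewrite (IHb _ _ _ Hu' Hu) in Hy'. eauto.
  - generalize (nsnd x) as n. intros n; revert y y'.
    induction n as [|n IH]; intros y y'; cbn; [eauto|].
    intros (z & Hz & Hy) (z' & Hz' & Hy').
    rewrite (IH _ _ Hz' Hz) in Hy'. eauto.
  - intros [H0 Hlt] [H0' Hlt'].
    destruct (lt_eq_lt_dec y y') as [[H|H]|H]; auto.
    + destruct (Hlt' _ H) as [k Hk]. discriminate (IHa _ _ _ H0 Hk).
    + destruct (Hlt _ H) as [k Hk]. discriminate (IHa _ _ _ H0' Hk).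
Qed.

Lemma prec_graph_iff (a b a' b' : mfun nat nat) (m n y : nat) :
  (forall x z, a x z <-> a' x z) -> (forall x z, b x z <-> b' x z) ->
  prec_graph a b m n y <-> prec_graph a' b' m n y.
Proof.
  intros Ha Hb; revert y; induction n as [|n IH]; intros y; cbn; [apply Ha|].
  split; intros (z & Hz & Hy); exists z; rewrite IH, Hb in *; auto.
Qed.

(** Each oracle query becomes a call of [d]; at the level of programs this is composition of
    functions on Baire space. *)
Fixpoint oracle_subst (c d : code) : code :=
  match c with
  | Oracle => d
  | Pair a b => Pair (oracle_subst a d) (oracle_subst b d)
  | Comp a b => Comp (oracle_subst a d) (oracle_subst b d)
  | Prec a b => Prec (oracle_subst a d) (oracle_subst b d)
  | Mu a => Mu (oracle_subst a d)
  | c => c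
  end.

Lemma eval_oracle_subst (u p : baire) (c d : code) :
  (forall k, eval u d k (p k)) ->
  forall x y, eval u (oracle_subst c d) x y <-> eval p c x y.
Proof.
  intros Hd.
  induction c as [| | | | |a IHa b IHb|a IHa b IHb|a IHa b IHb|a IHa];
    intros x y; cbn; try reflexivity.
  (* Determinism makes [p x] the only value that [d] can return at [x]. *)
  - split; [|intros ->; apply Hd]. intros H. exact (eval_single _ _ _ _ _ H (Hd x)).
  - split; intros (v & w & Hv & Hw & Hy); exists v, w; rewrite IHa, IHb in *; auto.
  - split; intros (v & Hv & Hy); exists v; rewrite IHa, IHb in *; auto.
  - now apply prec_graph_iff.
  - split; intros [H0 Hlt]; (split; [now apply IHa|]); intros i Hi;
      destruct (Hlt i Hi) as [k Hk]; exists k; now apply IHa.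
Qed.

(** * Uniformly computable families *)

(** An index carries an oracle together with data depending on it, and one program must serve all
    indices. This uniformity later yields a single program for all names. *)
Definition ucomp {I : Type} (o : I -> baire) (F : I -> nat -> nat) : Prop :=
  exists c, forall i x, eval (o i) c x (F i x).

Definition udec {I : Type} (o : I -> baire) (b : I -> nat -> bool) : Prop :=
  ucomp o (fun i x => Nat.b2n (b i x)).

Section UniformComputability.
Context {I : Type} {o : I -> baire}.
Implicit Types F G A B U : I -> nat -> nat.

Lemma ucomp_ext F G : (forall i x, F i x = G i x) -> ucomp o F -> ucomp o G.
Proof. intros E [c Hc]. exists c. intros i x. rewrite <- E. apply Hc. Qed.

Lemma ucomp_id : ucomp o (fun _ x => x).
Proof.
  exists (Pair Fst Snd). intros i x. exists (nfst x), (nsnd x).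
  repeat split. symmetry; apply npair_eta.
Qed.

Lemma ucomp_comp F A :
  ucomp o F -> ucomp o A -> ucomp o (fun i x => F i (A i x)).
Proof. intros [c Hc] [d Hd]. exists (Comp c d). intros i x. exists (A i x); auto. Qed.

Lemma ucomp_pair A B :
  ucomp o A -> ucomp o B -> ucomp o (fun i x => npair (A i x) (B i x)).
Proof.
  intros [c Hc] [d Hd]. exists (Pair c d). intros i x.
  exists (A i x), (B i x); auto.
Qed.

(** Since programs are unary, computability of a binary function is shown on coded pairs; this rule
    then applies it to separate arguments. *)
Lemma ucomp_comp2 (F : I -> nat -> nat -> nat) A B :
  ucomp o (fun i v => F i (nfst v) (nsnd v)) -> ucomp o A -> ucomp o B ->
  ucomp o (fun i x => F i (A i x) (B i x)).
Proof.
  intros HF HA HB.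
  apply (ucomp_ext (fun i x => F i (nfst (npair (A i x) (B i x)))
                                   (nsnd (npair (A i x) (B i x))))).
  { intros; now rewrite nfst_npair, nsnd_npair. }
  exact (ucomp_comp _ _ HF (ucomp_pair _ _ HA HB)).
Qed.

Lemma ucomp_fst A : ucomp o A -> ucomp o (fun i x => nfst (A i x)).
Proof. apply (ucomp_comp (fun _ x => nfst x)). now exists Fst. Qed.

Lemma ucomp_snd A : ucomp o A -> ucomp o (fun i x => nsnd (A i x)).
Proof. apply (ucomp_comp (fun _ x => nsnd x)). now exists Snd. Qed.

Lemma ucomp_S A : ucomp o A -> ucomp o (fun i x => S (A i x)).
Proof. apply (ucomp_comp (fun _ x => S x)). now exists Succ. Qed.

Lemma ucomp_const n : ucomp o (fun _ _ => n).
Proof. induction n as [|n IH]; [now exists Zero | now apply ucomp_S]. Qed.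

(** The packing [(x, (n, z))] of parameter, counter and previous value is the one that [Prec] passes
    to its step program. *)
Lemma ucomp_rec U A (F : I -> nat -> nat -> nat -> nat) :
  ucomp o U -> ucomp o A ->
  ucomp o (fun i v => F i (nfst v) (nfst (nsnd v)) (nsnd (nsnd v))) ->
  ucomp o (fun i x => nat_rect (fun _ => nat) (A i x) (F i x) (U i x)).
Proof.
  intros HU [a Ha] [b Hb].
  apply (ucomp_comp2
    (fun i x n => nat_rect (fun _ => nat) (A i x) (F i x) n) (fun _ x => x) U);
    [|exact ucomp_id|exact HU].
  exists (Prec a b). intros i v. cbn. generalize (nfst v) as x, (nsnd v) as n.
  intros x n; induction n as [|n IH]; cbn; [apply Ha|].
  eexists; split; [exact IH|].
  pose proof (Hb i (npair x (npair n
    (nat_rect (fun _ => nat) (A i x) (F i x) n)))) as H.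
  now rewrite !nsnd_npair, !nfst_npair in H.
Qed.

Lemma ucomp_case U A (F : I -> nat -> nat -> nat) :
  ucomp o U -> ucomp o A -> ucomp o (fun i v => F i (nfst v) (nsnd v)) ->
  ucomp o (fun i x => match U i x with 0 => A i x | S n => F i x n end).
Proof.
  intros HU HA HF.
  apply (ucomp_ext (fun i x =>
    nat_rect (fun _ => nat) (A i x) (fun n _ => F i x n) (U i x))).
  { intros i x. now destruct (U i x). }
  apply (ucomp_rec U A (fun i x n _ => F i x n)); auto.
  apply ucomp_comp2; auto using ucomp_fst, ucomp_snd, ucomp_id.
Qed.

Lemma ucomp_if (b : I -> nat -> bool) A B :
  udec o b -> ucomp o A -> ucomp o B ->
  ucomp o (fun i x => if b i x then A i x else B i x).
Proof.
  intros Hb HA HB.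
  apply (ucomp_ext (fun i x =>
    match Nat.b2n (b i x) with 0 => B i x | S _ => A i x end)).
  { intros i x. now destruct (b i x). }
  apply (ucomp_case _ B (fun i x _ => A i x)); auto.
  apply (ucomp_comp A); auto using ucomp_fst, ucomp_id.
Qed.

Lemma udec_if (b c d : I -> nat -> bool) :
  udec o b -> udec o c -> udec o d ->
  udec o (fun i x => if b i x then c i x else d i x).
Proof.
  intros Hb Hc Hd.
  eapply ucomp_ext; [|exact (ucomp_if b _ _ Hb Hc Hd)].
  intros i x; cbn. now destruct (b i x).
Qed.

Lemma udec_const (b : bool) : udec o (fun _ _ => b).
Proof. exact (ucomp_const (Nat.b2n b)). Qed.

Lemma udec_case U (b : I -> nat -> bool) (c : I -> nat -> nat -> bool) :
  ucomp o U -> udec o b -> udec o (fun i v => c i (nfst v) (nsnd v)) ->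
  udec o (fun i x => match U i x with 0 => b i x | S n => c i x n end).
Proof.
  intros HU Hb Hc.
  eapply ucomp_ext; [|exact (ucomp_case U _ (fun i x n => Nat.b2n (c i x n)) HU Hb Hc)].
  intros i x; cbn. now destruct (U i x).
Qed.

(** * Arithmetic operations and decidable comparisons *)

Lemma ucomp_add A B :
  ucomp o A -> ucomp o B -> ucomp o (fun i x => A i x + B i x).
Proof.
  intros HA HB.
  apply (ucomp_ext (fun i x => nat_rect (fun _ => nat) (B i x) (fun _ z => S z) (A i x))).
  { intros i x. induction (A i x); cbn; auto. }
  apply (ucomp_rec A B (fun _ _ _ z => S z)); auto using ucomp_S, ucomp_snd, ucomp_id.
Qed.

Lemma ucomp_mul A B :
  ucomp o A -> ucomp o B -> ucomp o (fun i x => A i x * B i x).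
Proof.
  intros HA HB.
  apply (ucomp_ext (fun i x => nat_rect (fun _ => nat) 0 (fun _ z => B i x + z) (A i x))).
  { intros i x. induction (A i x); cbn; auto. }
  apply (ucomp_rec A _ (fun i x _ z => B i x + z)); auto using ucomp_const.
  apply ucomp_add; auto using ucomp_snd, ucomp_id.
  apply (ucomp_comp B); auto using ucomp_fst, ucomp_id.
Qed.

Lemma ucomp_pow2 A : ucomp o A -> ucomp o (fun i x => 2 ^ A i x).
Proof.
  intros HA.
  apply (ucomp_ext (fun i x => nat_rect (fun _ => nat) 1 (fun _ z => 2 * z) (A i x))).
  { intros i x. induction (A i x); cbn in *; auto. }
  apply (ucomp_rec A _ (fun _ _ _ z => 2 * z)); auto using ucomp_const.
  apply ucomp_mul; auto using ucomp_const, ucomp_snd, ucomp_id.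
Qed.

Lemma ucomp_pred A : ucomp o A -> ucomp o (fun i x => pred (A i x)).
Proof.
  intros HA. apply (ucomp_case A _ (fun _ _ n => n));
    auto using ucomp_const, ucomp_snd, ucomp_id.
Qed.

Lemma ucomp_sub A B :
  ucomp o A -> ucomp o B -> ucomp o (fun i x => A i x - B i x).
Proof.
  intros HA HB.
  apply (ucomp_ext (fun i x => nat_rect (fun _ => nat) (A i x) (fun _ z => pred z) (B i x))).
  { intros i x. induction (B i x) as [|n IH]; cbn; [lia|rewrite IH; lia]. }
  apply (ucomp_rec B A (fun _ _ _ z => pred z)); auto using ucomp_pred, ucomp_snd, ucomp_id.
Qed.

Lemma udec_leb A B : ucomp o A -> ucomp o B -> udec o (fun i x => A i x <=? B i x).
Proof.
  intros HA HB.
  apply (ucomp_ext (fun i x => match A i x - B i x with 0 => 1 | S _ => 0 end)).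
  { intros i x. destruct (Nat.leb_spec (A i x) (B i x)).
    - now replace (A i x - B i x) with 0 by lia.
    - now replace (A i x - B i x) with (S (A i x - B i x - 1)) by lia. }
  apply (ucomp_case _ _ (fun _ _ _ => 0)); auto using ucomp_sub, ucomp_const.
Qed.

Lemma udec_ltb A B : ucomp o A -> ucomp o B -> udec o (fun i x => A i x <? B i x).
Proof. intros HA HB. apply (udec_leb (fun i x => S (A i x))); auto using ucomp_S. Qed.

Lemma udec_andb (b c : I -> nat -> bool) :
  udec o b -> udec o c -> udec o (fun i x => b i x && c i x).
Proof. intros Hb Hc. apply (udec_if b c); auto using udec_const. Qed.

Lemma udec_orb (b c : I -> nat -> bool) :
  udec o b -> udec o c -> udec o (fun i x => b i x || c i x).
Proof. intros Hb Hc. apply (udec_if b _ c); auto using udec_const. Qed.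

Lemma udec_negb (b : I -> nat -> bool) :
  udec o b -> udec o (fun i x => negb (b i x)).
Proof. intros Hb. apply udec_if; auto using udec_const. Qed.

Lemma udec_eqb A B : ucomp o A -> ucomp o B -> udec o (fun i x => A i x =? B i x).
Proof.
  intros HA HB.
  apply (ucomp_ext (fun i x => Nat.b2n ((A i x <=? B i x) && (B i x <=? A i x)))).
  { intros i x. f_equal. apply eq_true_iff_eq.
    rewrite andb_true_iff, !Nat.leb_le, Nat.eqb_eq. lia. }
  apply udec_andb; auto using udec_leb.
Qed.

Lemma udec_even A : ucomp o A -> udec o (fun i x => Nat.even (A i x)).
Proof.
  intros HA.
  apply (ucomp_ext (fun i x => nat_rect (fun _ => nat) 1 (fun _ z => 1 - z) (A i x))).
  { intros i x. induction (A i x) as [|n IH]; [reflexivity|].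
    rewrite Nat.even_succ, <- Nat.negb_even. cbn [nat_rect]. rewrite IH.
    now destruct (Nat.even n). }
  apply (ucomp_rec A _ (fun _ _ _ z => 1 - z)); auto using ucomp_const.
  apply ucomp_sub; auto using ucomp_const, ucomp_snd, ucomp_id.
Qed.

Lemma ucomp_div2 A : ucomp o A -> ucomp o (fun i x => Nat.div2 (A i x)).
Proof.
  intros HA.
  (* Passing from [n] to [S n] raises the half exactly when [n] is odd. *)
  apply (ucomp_ext (fun i x => nat_rect (fun _ => nat) 0
    (fun n z => if Nat.even n then z else S z) (A i x))).
  { intros i x. induction (A i x) as [|n IH]; [reflexivity|].
    cbn [nat_rect]. rewrite IH.
    pose proof (Nat.div2_odd n) as E. pose proof (Nat.div2_odd (S n)) as E'.
    rewrite Nat.odd_succ, <- Nat.negb_odd in E'. rewrite <- Nat.negb_odd.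
    destruct (Nat.odd n); cbn [negb Nat.b2n] in *; lia. }
  apply (ucomp_rec A _ (fun _ _ n z => if Nat.even n then z else S z));
    auto using ucomp_const.
  apply ucomp_if; auto using udec_even, ucomp_S, ucomp_fst, ucomp_snd, ucomp_id.
Qed.

Lemma ucomp_mod_pow2 A B :
  ucomp o A -> ucomp o B -> ucomp o (fun i x => A i x mod 2 ^ B i x).
Proof.
  intros HA HB.
  (* The remainder is a counter that is reset to zero whenever it reaches the modulus. *)
  apply (ucomp_ext (fun i x => nat_rect (fun _ => nat) 0
    (fun n z => if S z =? 2 ^ B i x then 0 else S z) (A i x))).
  { intros i x. set (d := 2 ^ B i x).
    assert (d <> 0) by (apply Nat.pow_nonzero; lia).
    induction (A i x) as [|n IH]; [now rewrite Nat.Div0.mod_0_l|].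
    cbn [nat_rect]. rewrite IH.
    pose proof (Nat.mod_upper_bound n d ltac:(lia)) as Hn.
    pose proof (Nat.div_mod_eq n d) as En.
    destruct (Nat.eqb_spec (S (n mod d)) d) as [E|E].
    - apply (Nat.mod_unique _ _ (S (n / d))); [lia|]. rewrite Nat.mul_succ_r. lia.
    - apply (Nat.mod_unique _ _ (n / d)); lia. }
  apply (ucomp_rec A _ (fun i x _ z => if S z =? 2 ^ B i x then 0 else S z));
    auto using ucomp_const.
  apply ucomp_if; auto using ucomp_const, ucomp_S, ucomp_snd, ucomp_id.
  apply udec_eqb; auto using ucomp_S, ucomp_snd, ucomp_id.
  apply ucomp_pow2. apply (ucomp_comp B); auto using ucomp_fst, ucomp_id.
Qed.

End UniformComputability.

(** Answering every query by [Zero] turns a program for the zero oracle into one whose result does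
    not depend on the oracle. *)
Lemma ucomp_recursive {I : Type} (o : I -> baire) (f : nat -> nat) :
  recursive f -> ucomp o (fun _ x => f x).
Proof.
  intros [c Hc]. exists (oracle_subst c Zero). intros i x.
  now apply (eval_oracle_subst (o i) (fun _ => 0)).
Qed.

Fixpoint bex (n : nat) (f : nat -> bool) : bool :=
  match n with 0 => false | S m => bex m f || f m end.

Lemma bex_spec n f : bex n f = true <-> exists m, m < n /\ f m = true.
Proof.
  induction n as [|n IH]; cbn.
  - split; [discriminate|]. intros (m & Hm & _); lia.
  - rewrite orb_true_iff, IH. split.
    + intros [(m & Hm & H)|H]; eauto.
    + intros (m & Hm & H). destruct (Nat.eq_dec m n) as [->|E]; auto.
      left; exists m; split; [lia|auto].
Qed.

Lemma udec_bex {I : Type} {o : I -> baire} U (f : I -> nat -> nat -> bool) :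
  ucomp o U -> udec o (fun i v => f i (nfst v) (nsnd v)) ->
  udec o (fun i x => bex (U i x) (f i x)).
Proof.
  intros HU Hf.
  apply (ucomp_ext (fun i x => nat_rect (fun _ => nat) 0
    (fun n z => match z with 0 => Nat.b2n (f i x n) | S _ => 1 end) (U i x))).
  { intros i x. induction (U i x) as [|n IH]; [reflexivity|].
    cbn. rewrite IH. now destruct (bex n (f i x)). }
  apply (ucomp_rec U _
    (fun i x n z => match z with 0 => Nat.b2n (f i x n) | S _ => 1 end));
    auto using ucomp_const.
  apply (ucomp_case _ _ (fun _ _ _ => 1)); auto using ucomp_const, ucomp_snd, ucomp_id.
  apply (ucomp_comp2 (fun i x n => Nat.b2n (f i x n)));
    auto using ucomp_fst, ucomp_snd, ucomp_id.
Qed.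

(** * Evaluation with bounded search and partial oracle *)

(* Partial values are coded in [nat]: [0] is "undefined", [S y] is "[y]".
   A search state is [0] (a value was undefined), [1] (no zero found so far),
   or [S (S n)] (the first zero is at [n]). *)
Definition search_state (f : nat -> nat) (N : nat) : nat :=
  nat_rect (fun _ => nat) 1
    (fun n st =>
       match st with
       | 0 => 0
       | S s => match s with
                | 0 => match f n with
                       | 0 => 0
                       | S u => match u with 0 => S (S n) | S _ => 1 end
                       end
                | S m => S (S m)
                end
       end) N.

(** Both clauses go through one induction: a first zero at [N] requires that state [1] was reached
    before, and an earlier zero must be preserved. *)
Lemma search_state_spec f N :
  (search_state f N = 1 <-> forall i, i < N -> exists k, f i = S (S k)) /\
  (forall y, search_state f N = S (S y) <->
     y < N /\ f y = 1 /\ forall i, i < y -> exists k, f i = S (S k)).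
Proof.
  induction N as [|N [IH1 IH2]].
  { cbn. split; [split; [lia|reflexivity]|]. intros y; split; [discriminate|lia]. }
  change (search_state f (S N)) with
    (match search_state f N with
     | 0 => 0
     | S s => match s with
              | 0 => match f N with
                     | 0 => 0
                     | S u => match u with 0 => S (S N) | S _ => 1 end
                     end
              | S m => S (S m)
              end
     end).
  destruct (search_state f N) as [|[|m]].
  - split; [split; [discriminate|]|intros y; split; [discriminate|]].
    + intros H. apply IH1. intros i Hi; apply H; lia.
    + intros (Hy & H0 & H). destruct (Nat.eq_dec y N) as [->|E].
      * enough (0 = 1) by discriminate. now apply IH1.
      * enough (0 = S (S y)) by discriminate. apply IH2. repeat split; auto; lia.
  - assert (H1 : forall i, i < N -> exists k, f i = S (S k)) by now apply IH1.
    assert (H2 : forall y, f y = 1 -> ~ y < N).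
    { intros y Hy Hl. destruct (H1 y Hl); congruence. }
    destruct (f N) as [|[|u]] eqn:E.
    + split; [split; [discriminate|]|intros y; split; [discriminate|]].
      * intros H. destruct (H N ltac:(lia)); congruence.
      * intros (Hy & H0 & _). specialize (H2 y H0).
        replace y with N in * by lia. congruence.
    + split; [split; [discriminate|]|intros y; split].
      * intros H. destruct (H N ltac:(lia)); congruence.
      * intros [= <-]. auto.
      * intros (Hy & H0 & _). specialize (H2 y H0). do 2 f_equal; lia.
    + split; [split; [intros _|reflexivity]|intros y; split; [discriminate|]].
      * intros i Hi. destruct (Nat.eq_dec i N) as [->|]; [eauto|apply H1; lia].
      * intros (Hy & H0 & _). specialize (H2 y H0).
        replace y with N in * by lia. congruence.
  - destruct (proj1 (IH2 m) eq_refl) as (Hm & H0 & Hl).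
    split; [split; [discriminate|]|intros y; split].
    + intros H. destruct (H m ltac:(lia)); congruence.
    + intros [= <-]. auto.
    + intros (Hy & H0' & Hl'). destruct (lt_eq_lt_dec m y) as [[L|L]|L]; auto.
      * destruct (Hl' _ L); congruence.
      * destruct (Hl _ L); congruence.
Qed.

(** Only [Mu] can run forever, so [N] bounds nothing but its searches, and [P] answers [0] where the
    oracle is still unknown. In the [Mu] case [pred] merges the states [0] and [1] into undefined
    and turns [S (S n)] into the coded value [S n]. *)
Fixpoint beval (P : nat -> nat) (N : nat) (c : code) (x : nat) : nat :=
  match c with
  | Zero => 1
  | Succ => S (S x)
  | Fst => S (nfst x)
  | Snd => S (nsnd x)
  | Oracle => P x
  | Pair a b =>
      match beval P N a x with
      | 0 => 0
      | S u => match beval P N b x with 0 => 0 | S v => S (npair u v) end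
      end
  | Comp a b => match beval P N b x with 0 => 0 | S u => beval P N a u end
  | Prec a b =>
      nat_rect (fun _ => nat) (beval P N a (nfst x))
        (fun n z => match z with
                    | 0 => 0
                    | S u => beval P N b (npair (nfst x) (npair n u))
                    end) (nsnd x)
  | Mu a => pred (search_state (fun n => beval P N a (npair x n)) N)
  end.

Lemma beval_mu_spec P N a x y :
  beval P N (Mu a) x = S y <->
  y < N /\ beval P N a (npair x y) = 1 /\
  forall i, i < y -> exists k, beval P N a (npair x i) = S (S k).
Proof.
  cbn [beval]. set (f := fun n => beval P N a (npair x n)).
  change (pred (search_state f N) = S y <->
    y < N /\ f y = 1 /\ forall i, i < y -> exists k, f i = S (S k)).
  rewrite <- (proj2 (search_state_spec f N) y).
  destruct (search_state f N); cbn; split; congruence.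
Qed.

(** A defined value rests on answered queries and completed searches only, and these survive more
    oracle information and a larger bound. *)
Lemma beval_mono P P' N N' c x y :
  (forall k v, P k = S v -> P' k = S v) -> N <= N' ->
  beval P N c x = S y -> beval P' N' c x = S y.
Proof.
  intros HP HN. revert x y.
  induction c as [| | | | |a IHa b IHb|a IHa b IHb|a IHa b IHb|a IHa];
    intros x y; try (cbn [beval]; now auto).
  - cbn [beval]. destruct (beval P N a x) as [|u] eqn:Ea; [discriminate|].
    destruct (beval P N b x) as [|v] eqn:Eb; [discriminate|].
    now rewrite (IHa _ _ Ea), (IHb _ _ Eb).
  - cbn [beval]. destruct (beval P N b x) as [|u] eqn:Eb; [discriminate|].
    rewrite (IHb _ _ Eb). apply IHa.
  - cbn [beval]. generalize (nsnd x) as n. intros n; revert y.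
    induction n as [|n IH]; intros y; cbn [nat_rect]; [apply IHa|].
    match goal with |- match ?z with _ => _ end = _ -> _ =>
      destruct z as [|u] eqn:E; [discriminate|] end.
    rewrite (IH _ eq_refl). apply IHb.
  - rewrite !beval_mu_spec. intros (Hy & H0 & Hl). repeat split; auto; [lia|].
    intros i Hi. destruct (Hl i Hi) as [k Hk]. eauto.
Qed.

Lemma beval_sound (p : baire) P N c x y :
  (forall k v, P k = S v -> v = p k) ->
  beval P N c x = S y -> eval p c x y.
Proof.
  intros HP. revert x y.
  induction c as [| | | | |a IHa b IHb|a IHa b IHb|a IHa b IHb|a IHa];
    intros x y; try (cbn; congruence).
  - apply HP.
  - cbn [beval]. destruct (beval P N a x) as [|u] eqn:Ea; [discriminate|].
    destruct (beval P N b x) as [|v] eqn:Eb; [discriminate|].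
    intros [= <-]. exists u, v; auto.
  - cbn [beval]. destruct (beval P N b x) as [|u] eqn:Eb; [discriminate|].
    intros H. exists u; auto.
  - cbn. generalize (nsnd x) as n. intros n; revert y.
    induction n as [|n IH]; intros y; cbn [nat_rect prec_graph]; [apply IHa|].
    match goal with |- match ?z with _ => _ end = _ -> _ =>
      destruct z as [|u] eqn:E; [discriminate|] end.
    intros H. exists u; auto.
  - rewrite beval_mu_spec. intros (Hy & H0 & Hl). split; [now apply IHa|].
    intros i Hi. destruct (Hl i Hi) as [k Hk]. exists k; auto.
Qed.

Lemma uniform_bound (Q : nat -> nat -> Prop) (y : nat) :
  (forall i N N', N <= N' -> Q i N -> Q i N') ->
  (forall i, i < y -> exists N, Q i N) ->
  exists N, forall i, i < y -> Q i N.
Proof.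
  intros Hm. induction y as [|y IH]; intros H.
  - exists 0; lia.
  - destruct IH as [N HN]; [auto|]. destruct (H y ltac:(lia)) as [M HM].
    exists (N + M). intros i Hi. destruct (Nat.eq_dec i y) as [->|].
    + apply (Hm _ M); auto; lia.
    + apply (Hm _ N); [lia|apply HN; lia].
Qed.

(** A halting computation makes finitely many queries and searches. Each subcomputation succeeds at
    some stage, and by monotonicity the sum of the stages serves them all. *)
Lemma beval_complete (p : baire) (P : nat -> nat -> nat) c x y :
  (forall N N' k v, N <= N' -> P N k = S v -> P N' k = S v) ->
  (forall k, exists N, P N k = S (p k)) ->
  eval p c x y -> exists N, beval (P N) N c x = S y.
Proof.
  intros HP Hlim.
  assert (Hmono : forall c x y N N', N <= N' ->
    beval (P N) N c x = S y -> beval (P N') N' c x = S y).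
  { intros c' x' y' N N' HN. apply beval_mono; eauto. }
  revert x y.
  induction c as [| | | | |a IHa b IHb|a IHa b IHb|a IHa b IHb|a IHa];
    intros x y; try (cbn; intros ->; first [now exists 0 | apply Hlim]).
  - cbn. intros (u & v & Hu & Hv & ->).
    destruct (IHa _ _ Hu) as [N HN], (IHb _ _ Hv) as [M HM]. exists (N + M).
    rewrite (Hmono _ _ _ N (N + M) ltac:(lia) HN).
    now rewrite (Hmono _ _ _ M (N + M) ltac:(lia) HM).
  - cbn. intros (u & Hu & Hy).
    destruct (IHb _ _ Hu) as [N HN], (IHa _ _ Hy) as [M HM]. exists (N + M).
    rewrite (Hmono _ _ _ N (N + M) ltac:(lia) HN). apply (Hmono _ _ _ M); auto; lia.
  - intros H.
    change (prec_graph (eval p a) (eval p b) (nfst x) (nsnd x) y) in H.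
    (* With the argument split into parameter and length, every intermediate value of the recursion
       is again a value of [Prec a b], so [Hmono] applies to it. *)
    enough (G : exists N, beval (P N) N (Prec a b) (npair (nfst x) (nsnd x)) = S y)
      by now rewrite npair_eta in G.
    revert H. generalize (nfst x) as m, (nsnd x) as n. intros m n; revert y.
    induction n as [|n IH]; intros y; cbn [prec_graph].
    + intros H. destruct (IHa _ _ H) as [N HN]. exists N.
      cbn [beval]. now rewrite nsnd_npair, nfst_npair.
    + intros (z & Hz & Hy).
      destruct (IH _ Hz) as [N HN], (IHb _ _ Hy) as [M HM]. exists (N + M).
      apply (Hmono _ _ _ N (N + M) ltac:(lia)) in HN.
      apply (Hmono _ _ _ M (N + M) ltac:(lia)) in HM.
      cbn [beval] in HN |- *. rewrite nsnd_npair, nfst_npair in *.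
      cbn [nat_rect]. now rewrite HN.
  - intros [H0 Hl].
    destruct (IHa _ _ H0) as [N HN].
    destruct (uniform_bound
      (fun i N => exists k, beval (P N) N a (npair x i) = S (S k)) y) as [M HM].
    + intros i K K' HK [k Hk]. exists k. now apply (Hmono _ _ _ K).
    + intros i Hi. destruct (Hl i Hi) as [k Hk].
      destruct (IHa _ _ Hk) as [K HK]. eauto.
    (* The summand [S y] lets the bounded search reach [y] itself. *)
    + exists (S y + N + M). rewrite beval_mu_spec. repeat split; [lia| |].
      * apply (Hmono _ _ _ N); auto; lia.
      * intros i Hi. destruct (HM i Hi) as [k Hk]. exists k.
        apply (Hmono _ _ _ M); auto; lia.
Qed.

(** The program [c] is fixed, so induction on it assembles an evaluator for it. The first component
    of [v] selects the partial oracle and the bound; the second is the input. *)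
Lemma ucomp_beval {I : Type} {o : I -> baire} (P : I -> nat -> nat -> nat)
    (B : I -> nat -> nat) (c : code) :
  ucomp o B -> ucomp o (fun i v => P i (nfst v) (nsnd v)) ->
  ucomp o (fun i v => beval (P i (nfst v)) (B i (nfst v)) c (nsnd v)).
Proof.
  intros HB HP.
  induction c as [| | | | |a IHa b IHb|a IHa b IHb|a IHa b IHb|a IHa]; cbn [beval];
    auto using ucomp_const, ucomp_S, ucomp_fst, ucomp_snd, ucomp_id.
  - apply (ucomp_case _ _ (fun i v u =>
      match beval (P i (nfst v)) (B i (nfst v)) b (nsnd v) with
      | 0 => 0 | S w => S (npair u w) end)); auto using ucomp_const.
    apply (ucomp_case _ _ (fun i v w => S (npair (nsnd v) w))); auto using ucomp_const.
    + apply (ucomp_comp (fun i v => beval (P i (nfst v)) (B i (nfst v)) b (nsnd v)));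
        auto using ucomp_fst, ucomp_id.
    + apply ucomp_S, ucomp_pair; auto using ucomp_fst, ucomp_snd, ucomp_id.
  - apply (ucomp_case _ _ (fun i v u => beval (P i (nfst v)) (B i (nfst v)) a u));
      auto using ucomp_const.
    apply (ucomp_comp2 (fun i e x => beval (P i e) (B i e) a x));
      auto using ucomp_fst, ucomp_snd, ucomp_id.
  - apply (ucomp_rec _ _ (fun i v n z => match z with 0 => 0 | S u =>
      beval (P i (nfst v)) (B i (nfst v)) b (npair (nfst (nsnd v)) (npair n u)) end));
      auto using ucomp_snd, ucomp_id.
    + apply (ucomp_comp2 (fun i e x => beval (P i e) (B i e) a x));
        auto using ucomp_fst, ucomp_snd, ucomp_id.
    + apply (ucomp_case _ _ (fun i v u =>
        beval (P i (nfst (nfst v))) (B i (nfst (nfst v))) b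
          (npair (nfst (nsnd (nfst v))) (npair (nfst (nsnd v)) u))));
        auto using ucomp_const, ucomp_snd, ucomp_id.
      apply (ucomp_comp2 (fun i e x => beval (P i e) (B i e) b x));
        auto 7 using ucomp_pair, ucomp_fst, ucomp_snd, ucomp_id.
  - apply ucomp_pred.
    apply (ucomp_rec _ _ (fun i v n st =>
       match st with
       | 0 => 0
       | S s => match s with
                | 0 => match beval (P i (nfst v)) (B i (nfst v)) a (npair (nsnd v) n) with
                       | 0 => 0
                       | S u => match u with 0 => S (S n) | S _ => 1 end
                       end
                | S m => S (S m)
                end
       end)); [|now apply ucomp_const|].
    { apply (ucomp_comp B); auto using ucomp_fst, ucomp_id. }
    apply (ucomp_case _ _ (fun i v s => match s with
       | 0 => match beval (P i (nfst (nfst v))) (B i (nfst (nfst v))) a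
                      (npair (nsnd (nfst v)) (nfst (nsnd v))) with
              | 0 => 0
              | S u => match u with 0 => S (S (nfst (nsnd v))) | S _ => 1 end
              end
       | S m => S (S m)
       end)); auto using ucomp_const, ucomp_snd, ucomp_id.
    apply (ucomp_case _ _ (fun _ _ m => S (S m)));
      auto using ucomp_S, ucomp_snd, ucomp_id.
    apply (ucomp_case _ _ (fun _ v u =>
      match u with 0 => S (S (nfst (nsnd (nfst v)))) | S _ => 1 end));
      auto using ucomp_const.
    { apply (ucomp_comp2 (fun i e x => beval (P i e) (B i e) a x));
        auto 7 using ucomp_pair, ucomp_fst, ucomp_snd, ucomp_id. }
    apply (ucomp_case _ _ (fun _ _ _ => 1));
      auto 8 using ucomp_const, ucomp_S, ucomp_fst, ucomp_snd, ucomp_id.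
Qed.

(** * Prefixes of points of Cantor space *)

(** The least significant digit comes first, as in [cantor_alpha]: used as an index, the number
    denotes the point that continues the word by zeros. *)
Fixpoint prefix (a : nat -> bool) (N : nat) : nat :=
  match N with
  | 0 => 0
  | S N' => prefix a N' + Nat.b2n (a N') * 2 ^ N'
  end.

Lemma prefix_lt a N : prefix a N < 2 ^ N.
Proof. induction N as [|N IH]; cbn; [lia|]. destruct (a N); cbn; lia. Qed.

Lemma prefix_mod a M N : M <= N -> prefix a N mod 2 ^ M = prefix a M.
Proof.
  induction 1 as [|N HN IH].
  - apply Nat.mod_small, prefix_lt.
  - cbn [prefix]. rewrite <- IH.
    replace (2 ^ N) with (2 ^ (N - M) * 2 ^ M)
      by (rewrite <- Nat.pow_add_r; f_equal; lia).
    rewrite Nat.mul_assoc. apply Nat.Div0.mod_add.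
Qed.

Lemma testbit_prefix a N j : j < N -> Nat.testbit (prefix a N) j = a j.
Proof.
  intros Hj. rewrite <- (Nat.mod_pow2_bits_low _ (S j)) by lia.
  rewrite prefix_mod by lia.
  apply (Nat.testbit_unique _ _ _ (prefix a j) 0); [apply prefix_lt|]. cbn. lia.
Qed.

Lemma mod_pow2_eq_iff x y M :
  x mod 2 ^ M = y mod 2 ^ M <->
  forall j, j < M -> Nat.testbit x j = Nat.testbit y j.
Proof.
  split.
  - intros E j Hj.
    rewrite <- (Nat.mod_pow2_bits_low x M), E by lia. now apply Nat.mod_pow2_bits_low.
  - intros H. apply Nat.bits_inj. intros j. destruct (Nat.lt_ge_cases j M).
    + rewrite !Nat.mod_pow2_bits_low; auto.
    + rewrite !Nat.mod_pow2_bits_high; auto.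
Qed.

Lemma prefix_testbit w N : w < 2 ^ N -> prefix (Nat.testbit w) N = w.
Proof.
  intros Hw.
  rewrite <- (Nat.mod_small w (2 ^ N)) at 2 by auto.
  rewrite <- (Nat.mod_small (prefix _ N) (2 ^ N)) by apply prefix_lt.
  apply mod_pow2_eq_iff. intros j Hj. now apply testbit_prefix.
Qed.

(** A word is kept if it has bad extensions at all later levels ([ext]). The path takes digit 0 when
    this keeps the property, and digit 1 otherwise. *)
Lemma weak_konig (bad : nat -> nat -> Prop) :
  (forall N, exists a, bad N (prefix a N)) ->
  (forall N M a, N <= M -> bad M (prefix a M) -> bad N (prefix a N)) ->
  exists a, forall N, bad N (prefix a N).
Proof.
  intros Hex Hmono.
  set (ext := fun N w => forall M, N <= M ->
    exists a, prefix a N = w /\ bad M (prefix a M)).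
  set (dec := fun N w => excluded_middle_informative (ext N w)).
  set (path := nat_rect (fun _ => nat) 0
    (fun N w => if dec (S N) w then w else w + 2 ^ N)).
  set (a := fun N => if dec (S N) (path N) then false else true).
  assert (Ha : forall N, prefix a N = path N).
  { induction N as [|N IH]; [reflexivity|]. cbn. rewrite IH.
    unfold a. fold (path N). destruct (dec (S N) (path N)); cbn; lia. }
  assert (Hext : forall N, ext N (path N)).
  { induction N as [|N IH].
    - intros M _. destruct (Hex M) as [b Hb]. exists b; auto.
    - cbn. fold (path N). destruct (dec (S N) (path N)) as [H|H]; [exact H|].
      apply not_all_ex_not in H. destruct H as [M0 H].
      intros M HM.
      (* At level [M0] the extension by 0 has no bad continuation, so a bad continuation at a level
         beyond both [M] and [M0] must take digit 1. *)
      destruct (IH (M + M0) ltac:(lia)) as (b & Eb & Hb).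
      exists b. split; [|apply (Hmono M (M + M0)); auto; lia].
      cbn. rewrite Eb. destruct (b N) eqn:E; cbn; [lia|]. exfalso.
      apply H. intros HM0. exists b. cbn. rewrite E, Eb. split; [cbn; lia|].
      apply (Hmono M0 (M + M0)); auto; lia. }
  exists a. intros N. destruct (Hext N N (le_n N)) as (b & Eb & Hb).
  now rewrite Ha, <- Eb.
Qed.

Local Open Scope R_scope.

(** * Cauchy names of points of Cantor space *)

Lemma cantor_dist_le (p q : nat -> bool) (M : nat) :
  (forall j, (j < M)%nat -> p j = q j) -> cantor_dist p q <= (/ 2) ^ M.
Proof.
  intros H. destruct (classic (p = q)) as [->|Hpq].
  - rewrite cantor_dist_same. pose proof (half_pow_pos M); lra.
  - destruct (first_diff_ex p q Hpq) as [i Hi].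
    rewrite (cantor_dist_first _ _ _ Hi). apply half_pow_le.
    destruct (Nat.lt_ge_cases i M) as [L|L]; auto.
    now elim (proj1 Hi); auto.
Qed.

(** Entry [m] has [m + 1] digits because the Cauchy condition is strict: [m] digits would only give
    a distance of at most [2^-m]. *)
Definition cantor_name (a : nat -> bool) : baire := fun m => prefix a (S m).

Lemma cantor_name_rep (a : nat -> bool) :
  cauchy_rep cantor_space (cantor_name a) a.
Proof.
  split.
  - intros m k Hmk. apply Rle_lt_trans with ((/ 2) ^ S m).
    + apply cantor_dist_le. intros j Hj. unfold cantor_name.
      cbn [alpha cantor_space cantor_alpha].
      unfold cantor_alpha. rewrite !testbit_prefix by lia. reflexivity.
    + cbn. pose proof (half_pow_pos m); lra.
  - intros eps He. destruct (half_pow_small eps He) as [N HN].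
    exists N. intros m Hm. apply Rle_lt_trans with ((/ 2) ^ S m).
    + apply cantor_dist_le. intros j Hj. now apply testbit_prefix.
    + apply HN; lia.
Qed.

(** * Refuting prefixes *)

(** This is membership of [a] in the closed set with [psi_minus]-name [r]. *)
Definition avoids (r : baire) (a : nat -> bool) : Prop :=
  ~ exists i, cball cantor_space (r i) a.

(* Balls are refuted through agreement with their centre on [M] digits, where
   [2^-M] is below the radius; the last conjunct states this without division. *)
Definition killed (r : baire) (N w : nat) : bool :=
  bex N (fun i => bex (S N) (fun M =>
    Nat.eqb (w mod 2 ^ M) (nfst (r i) mod 2 ^ M) &&
    Nat.ltb (S (nsnd (nsnd (r i)))) (nfst (nsnd (r i)) * 2 ^ M))).

Lemma killed_spec r N w :
  killed r N w = true <->
  exists i M, (i < N)%nat /\ (M <= N)%nat /\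
    (forall j, (j < M)%nat -> Nat.testbit w j = Nat.testbit (nfst (r i)) j) /\
    (/ 2) ^ M < qenum (nsnd (r i)).
Proof.
  assert (E : forall k M, (S (nsnd k) < nfst k * 2 ^ M)%nat <-> (/ 2) ^ M < qenum k).
  { intros k M. unfold qenum.
    assert (0 < INR (S (nsnd k))) by (apply lt_0_INR; lia).
    assert (H2 : 0 < 2 ^ M) by (apply pow_lt; lra).
    rewrite pow_inv.
    assert (Hi : INR (2 ^ M)%nat = 2 ^ M) by now rewrite pow_INR.
    split; intros L.
    - apply lt_INR in L. rewrite mult_INR, Hi in L.
      apply Rmult_lt_reg_r with (2 ^ M * INR (S (nsnd k))).
      + now apply Rmult_lt_0_compat.
      + field_simplify; lra.
    - apply INR_lt. rewrite mult_INR, Hi.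
      apply (Rmult_lt_compat_r (2 ^ M * INR (S (nsnd k)))) in L.
      + field_simplify in L; lra.
      + now apply Rmult_lt_0_compat. }
  unfold killed. rewrite bex_spec. split.
  - intros (i & Hi & H). apply bex_spec in H. destruct H as (M & HM & H).
    apply andb_true_iff in H. destruct H as [H1 H2].
    apply Nat.eqb_eq in H1. apply Nat.ltb_lt in H2.
    exists i, M. repeat split; auto; [lia|now apply mod_pow2_eq_iff|now apply E].
  - intros (i & M & Hi & HM & Hw & Hq). exists i; split; auto.
    apply bex_spec. exists M; split; [lia|]. apply andb_true_iff.
    now rewrite Nat.eqb_eq, Nat.ltb_lt, mod_pow2_eq_iff, E.
Qed.

(** A refutation compares [M <= N] digits only, and a longer prefix has the same ones. *)
Lemma killed_mono r a N N' : (N <= N')%nat ->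
  killed r N (prefix a N) = true -> killed r N' (prefix a N') = true.
Proof.
  intros HN. rewrite !killed_spec. intros (i & M & Hi & HM & Hw & Hq).
  exists i, M. repeat split; auto; try lia. intros j Hj. rewrite <- Hw by auto.
  rewrite !testbit_prefix by lia. reflexivity.
Qed.

Lemma killed_sound r a N : killed r N (prefix a N) = true -> ~ avoids r a.
Proof.
  rewrite killed_spec. intros (i & M & Hi & HM & Hw & Hq) H. apply H. exists i.
  eapply Rle_lt_trans; [|exact Hq]. apply cantor_dist_le.
  intros j Hj. rewrite <- Hw by auto. apply testbit_prefix; lia.
Qed.

(** If [a] differs from the centre of the ball, the position [M] of the first difference works:
    [2^-M] is the distance itself, hence below the radius. If [a] is the centre, any [M] with [2^-M]
    below the radius does. *)
Lemma killed_complete r a :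
  ~ avoids r a -> exists N, killed r N (prefix a N) = true.
Proof.
  intros H. apply NNPP in H. destruct H as [i Hi].
  change (cantor_dist (Nat.testbit (nfst (r i))) a < qenum (nsnd (r i))) in Hi.
  assert (exists M, (forall j, (j < M)%nat -> Nat.testbit (nfst (r i)) j = a j) /\
    (/ 2) ^ M < qenum (nsnd (r i))) as (M & HM & Hq).
  { destruct (classic (Nat.testbit (nfst (r i)) = a)) as [E|E].
    - rewrite <- E, cantor_dist_same in Hi.
      destruct (half_pow_small _ Hi) as [M HM]. exists M; split; auto.
      intros j _. now rewrite <- E.
    - destruct (first_diff_ex _ _ E) as [M HM].
      rewrite (cantor_dist_first _ _ _ HM) in Hi. exists M; split; auto. apply HM. }
  exists (S i + M)%nat. apply killed_spec. exists i, M. repeat split; auto; try lia.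
  intros j Hj. rewrite testbit_prefix by lia. symmetry; auto.
Qed.

Lemma udec_killed {I : Type} {o : I -> baire} (r : I -> baire) A B :
  ucomp o r -> ucomp o A -> ucomp o B ->
  udec o (fun i x => killed (r i) (A i x) (B i x)).
Proof.
  intros Hr HA HB.
  assert (Hr' : forall C, ucomp o C -> ucomp o (fun i x => r i (C i x)))
    by (intros C HC; now apply (ucomp_comp r)).
  assert (HA' : forall C, ucomp o C -> ucomp o (fun i x => A i (C i x)))
    by (intros C HC; now apply (ucomp_comp A)).
  assert (HB' : forall C, ucomp o C -> ucomp o (fun i x => B i (C i x)))
    by (intros C HC; now apply (ucomp_comp B)).
  unfold killed.
  apply (udec_bex A (fun i x k => bex (S (A i x)) (fun M =>
    Nat.eqb (B i x mod 2 ^ M) (nfst (r i k) mod 2 ^ M) &&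
    Nat.ltb (S (nsnd (nsnd (r i k)))) (nfst (nsnd (r i k)) * 2 ^ M)))); auto.
  apply (udec_bex _ (fun i x M =>
    Nat.eqb (B i (nfst x) mod 2 ^ M) (nfst (r i (nsnd x)) mod 2 ^ M) &&
    Nat.ltb (S (nsnd (nsnd (r i (nsnd x))))) (nfst (nsnd (r i (nsnd x))) * 2 ^ M)));
    auto using ucomp_S, ucomp_fst, ucomp_id.
  apply udec_andb.
  - apply udec_eqb; apply ucomp_mod_pow2; auto 8 using ucomp_fst, ucomp_snd, ucomp_id.
  - apply udec_ltb; [|apply ucomp_mul; [|apply ucomp_pow2]];
      auto 8 using ucomp_S, ucomp_fst, ucomp_snd, ucomp_id.
Qed.

(** * The pairing of an oracle with a finite prefix *)

(** A partial form of [bpair t (cantor_name a)] in which only the word [w] of length [N] is known of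
    [a]. An entry of [cantor_name] is a shorter prefix, recovered from [w] as a remainder; it is
    undefined once [w] is too short. *)
Definition prefix_oracle (t : baire) (N w k : nat) : nat :=
  if Nat.even k then S (t (Nat.div2 k))
  else if Nat.ltb (Nat.div2 k) N then S (w mod 2 ^ S (Nat.div2 k)) else 0.

Lemma prefix_oracle_name t a N k v :
  prefix_oracle t N (prefix a N) k = S v -> v = bpair t (cantor_name a) k.
Proof.
  unfold prefix_oracle, bpair, cantor_name. destruct (Nat.even k); [congruence|].
  destruct (Nat.ltb_spec (Nat.div2 k) N); [|discriminate].
  rewrite prefix_mod by lia. congruence.
Qed.

Lemma prefix_oracle_mono t a N N' k v : (N <= N')%nat ->
  prefix_oracle t N (prefix a N) k = S v ->
  prefix_oracle t N' (prefix a N') k = S v.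
Proof.
  intros HN. unfold prefix_oracle. destruct (Nat.even k); [auto|].
  destruct (Nat.ltb_spec (Nat.div2 k) N); [|discriminate].
  destruct (Nat.ltb_spec (Nat.div2 k) N'); [|lia].
  now rewrite !prefix_mod by lia.
Qed.

Lemma prefix_oracle_limit t a k :
  exists N, prefix_oracle t N (prefix a N) k = S (bpair t (cantor_name a) k).
Proof.
  exists (S (Nat.div2 k)). unfold prefix_oracle, bpair, cantor_name.
  destruct (Nat.even k); [reflexivity|].
  destruct (Nat.ltb_spec (Nat.div2 k) (S (Nat.div2 k))); [|lia].
  now rewrite prefix_mod by lia.
Qed.

Lemma ucomp_prefix_oracle {I : Type} {o : I -> baire} (t : I -> baire) A B C :
  ucomp o t -> ucomp o A -> ucomp o B -> ucomp o C ->
  ucomp o (fun i x => prefix_oracle (t i) (A i x) (B i x) (C i x)).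
Proof.
  intros Ht HA HB HC. unfold prefix_oracle. apply ucomp_if.
  - now apply udec_even.
  - apply ucomp_S. apply (ucomp_comp t); auto using ucomp_div2.
  - apply ucomp_if; auto using udec_ltb, ucomp_div2, ucomp_const.
    apply ucomp_S, ucomp_mod_pow2; auto using ucomp_S, ucomp_div2.
Qed.

(** * Exhaustive search *)

Lemma cauchy_rep_dist_le (Y : DenseMetricSpace) p y m :
  cauchy_rep Y p y -> dist Y (alpha Y (p m)) y <= (/ 2) ^ m.
Proof.
  intros [Hc Hl]. apply Rnot_lt_le; intros H.
  destruct (Hl (dist Y (alpha Y (p m)) y - (/ 2) ^ m)) as [N HN]; [lra|].
  specialize (HN (S (N + m)) ltac:(lia)). specialize (Hc m (S (N + m)) ltac:(lia)).
  pose proof (dist_tri Y (alpha Y (p m)) y (alpha Y (p (S (N + m))))). lra.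
Qed.

(** Half the usual error is demanded so that the errors of two entries together stay below
    [2^-m]. *)
Lemma cauchy_rep_of_dist_lt (Y : DenseMetricSpace) p y :
  (forall m, dist Y (alpha Y (p m)) y < (/ 2) ^ S m) -> cauchy_rep Y p y.
Proof.
  intros Hp. split.
  - intros m k Hmk. pose proof (Hp m) as Hm. pose proof (Hp k) as Hk.
    pose proof (dist_tri Y (alpha Y (p m)) (alpha Y (p k)) y) as Ht.
    rewrite (dist_sym Y y (alpha Y (p k))) in Ht.
    pose proof (half_pow_le m k ltac:(lia)). simpl in Hm, Hk. lra.
  - intros eps He. destruct (half_pow_small eps He) as [N HN].
    exists N; intros m Hm. specialize (HN (S m) ltac:(lia)). specialize (Hp m). lra.
Qed.

(** An odd [s] makes the fraction non-positive, so the comparison holds; for even [s] it is cleared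
    of denominators. *)
Lemma signed_fraction_lt s a b e : b <> 0%nat ->
  negb (Nat.even s) || Nat.ltb (a * 2 ^ e) b = true <->
  (-1) ^ s * INR a / INR b < (/ 2) ^ e.
Proof.
  intros Hb.
  assert (0 < INR b) by (apply lt_0_INR; lia).
  assert (H2 : 0 < 2 ^ e) by (apply pow_lt; lra).
  pose proof (pos_INR a). pose proof (half_pow_pos e).
  destruct (Nat.even s) eqn:Es; cbn [negb orb].
  - apply Nat.even_spec in Es. destruct Es as [m ->]. rewrite pow_1_even, Rmult_1_l.
    rewrite Nat.ltb_lt, pow_inv.
    assert (Hi : INR (2 ^ e)%nat = 2 ^ e) by now rewrite pow_INR.
    split; intros L.
    + apply lt_INR in L. rewrite mult_INR, Hi in L.
      apply Rmult_lt_reg_r with (2 ^ e * INR b); [now apply Rmult_lt_0_compat|].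
      field_simplify; lra.
    + apply INR_lt. rewrite mult_INR, Hi.
      apply (Rmult_lt_compat_r (2 ^ e * INR b)) in L; [|now apply Rmult_lt_0_compat].
      field_simplify in L; lra.
  - assert (Ho : Nat.odd s = true) by now rewrite <- Nat.negb_even, Es.
    apply Nat.odd_spec in Ho. destruct Ho as [m ->].
    rewrite Nat.add_1_r, pow_1_odd. split; [intros _|reflexivity].
    assert (0 <= INR a / INR b) by (apply Rle_mult_inv_pos; lra).
    replace (-1 * INR a / INR b) with (- (INR a / INR b)) by (field; lra). lra.
Qed.

(** Let [e = 2^-(k+5)]. The test asks whether a rational within [e] of the distance is below
    [4e = 2^-(k+3)]: acceptance gives a distance below [5e], while a distance of at most [2e] gives
    a rational of at most [3e]. *)
Lemma exists_distance_test (Y : CompMetricSpace) :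
  exists near : nat -> nat -> nat -> bool,
    (forall I (o : I -> baire) A B C, ucomp o A -> ucomp o B -> ucomp o C ->
       udec o (fun i x => near (A i x) (B i x) (C i x))) /\
    (forall k i j, near k i j = true ->
       dist Y (alpha Y i) (alpha Y j) < 5 * (/ 2) ^ (k + 5)) /\
    (forall k i j, dist Y (alpha Y i) (alpha Y j) <= 2 * (/ 2) ^ (k + 5) ->
       near k i j = true).
Proof.
  destruct (dist_computable Y) as (s & a & b & Hs & Ha & Hb & Hb0 & Happ).
  set (tr := fun k i j : nat => npair i (npair j (k + 5))).
  exists (fun k i j => negb (Nat.even (s (tr k i j))) ||
                 Nat.ltb (a (tr k i j) * 2 ^ (k + 3)) (b (tr k i j))).
  assert (E : forall k i j,
    negb (Nat.even (s (tr k i j))) ||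
      Nat.ltb (a (tr k i j) * 2 ^ (k + 3)) (b (tr k i j)) = true <->
    (-1) ^ (s (tr k i j)) * INR (a (tr k i j)) / INR (b (tr k i j))
      < 4 * (/ 2) ^ (k + 5)).
  { intros k i j. rewrite signed_fraction_lt by auto.
    replace (4 * (/ 2) ^ (k + 5)) with ((/ 2) ^ (k + 3))
      by (rewrite !pow_add; simpl; field). reflexivity. }
  split; [|split].
  - intros I o A B C HA HB HC. unfold tr.
    assert (Ht : ucomp o (fun i x => npair (B i x) (npair (C i x) (A i x + 5)))).
    { apply ucomp_pair, ucomp_pair, ucomp_add; auto using ucomp_const. }
    apply udec_orb.
    + apply udec_negb, udec_even.
      exact (ucomp_comp (fun _ => s) _ (ucomp_recursive o s Hs) Ht).
    + apply udec_ltb; [apply ucomp_mul|].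
      * exact (ucomp_comp (fun _ => a) _ (ucomp_recursive o a Ha) Ht).
      * apply ucomp_pow2, ucomp_add; auto using ucomp_const.
      * exact (ucomp_comp (fun _ => b) _ (ucomp_recursive o b Hb) Ht).
  - intros k i j H. apply E in H. specialize (Happ i j (k + 5)%nat).
    cbv zeta in Happ. fold (tr k i j) in Happ.
    unfold Rabs in Happ. destruct (Rcase_abs _) in Happ; lra.
  - intros k i j H. apply E. specialize (Happ i j (k + 5)%nat).
    cbv zeta in Happ. fold (tr k i j) in Happ.
    pose proof (half_pow_pos (k + 5)).
    unfold Rabs in Happ. destruct (Rcase_abs _) in Happ; lra.
Qed.

Lemma eval_mu_least (u : baire) (c : code) (f : nat -> nat -> nat) k v :
  (forall k v, eval u c (npair k v) (f k v)) -> f k v = 0%nat ->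
  exists v', eval u (Mu c) k v' /\ f k v' = 0%nat.
Proof.
  intros Hc. induction v as [v IH] using lt_wf_ind. intros Hv.
  destruct (classic (exists v', (v' < v)%nat /\ f k v' = 0%nat)) as [(v' & Hl & H)|H].
  - eauto.
  - exists v. split; auto. split; [rewrite <- Hv; apply Hc|].
    intros i Hi. destruct (f k i) as [|n] eqn:E; [exfalso; eauto|].
    exists n. rewrite <- E. apply Hc.
Qed.

Lemma exhaustive_search (Y : CompMetricSpace) (ct cr cg : code) :
  exists d, forall u t r y,
    (forall k, eval u ct k (t k)) -> (forall k, eval u cr k (r k)) ->
    (exists a, avoids r a) ->
    (forall a, avoids r a -> exists q,
       (forall k, eval (bpair t (cantor_name a)) cg k (q k)) /\ cauchy_rep Y q y) ->
    exists q, (forall k, eval u d k (q k)) /\ cauchy_rep Y q y.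
Proof.
  destruct (exists_distance_test Y) as (near & Hnear & near_sound & near_complete).
  (* An index is a triple [(u, t, r)] in which [ct] and [cr] compute [t] and [r] from [u]; this
     makes [t] and [r] uniformly computable. *)
  set (I := {i : baire * baire * baire |
    (forall k, eval (fst (fst i)) ct k (snd (fst i) k)) /\
    (forall k, eval (fst (fst i)) cr k (snd i k))}).
  set (o := fun i : I => fst (fst (proj1_sig i))).
  set (tt := fun i : I => snd (fst (proj1_sig i))).
  set (rr := fun i : I => snd (proj1_sig i)).
  assert (Ht : ucomp o tt) by (exists ct; intros i; apply (proj1 (proj2_sig i))).
  assert (Hr : ucomp o rr) by (exists cr; intros i; apply (proj2 (proj2_sig i))).
  (* A word that is not refuted and on which the evaluation of [cg] is undefined counts as
     rejected. *)
  set (accepts := fun (t r : baire) k N m w =>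
    killed r N w ||
    match beval (prefix_oracle t N w) N cg (k + 5) with
    | 0%nat => false
    | S j => near k j m
    end).
  (* Here [v] codes the length [N] and the candidate [m]. Value 0 means that all words of length [N]
     are accepted, since [Mu] looks for zeros. *)
  set (test := fun t r k v =>
    Nat.b2n (bex (2 ^ nfst v) (fun w => negb (accepts t r k (nfst v) (nsnd v) w)))).
  assert (Htest : ucomp o (fun i x => test (tt i) (rr i) (nfst x) (nsnd x))).
  { unfold test. apply (udec_bex _ (fun i x w => negb
      (accepts (tt i) (rr i) (nfst x) (nfst (nsnd x)) (nsnd (nsnd x)) w)));
      auto using ucomp_pow2, ucomp_fst, ucomp_snd, ucomp_id.
    apply udec_negb, udec_orb.
    - apply udec_killed; auto using ucomp_fst, ucomp_snd, ucomp_id.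
    - apply (udec_case _ _ (fun i x j =>
        near (nfst (nfst x)) j (nsnd (nsnd (nfst x))))).
      + apply (ucomp_ext (fun i x =>
          beval (prefix_oracle (tt i) (nfst (npair (nfst (nsnd (nfst x))) (nsnd x)))
                               (nsnd (npair (nfst (nsnd (nfst x))) (nsnd x))))
            (nfst (npair (nfst (nsnd (nfst x))) (nsnd x))) cg (nfst (nfst x) + 5))).
        { intros i x. now rewrite nfst_npair, nsnd_npair. }
        apply (ucomp_comp2 (fun i e x =>
          beval (prefix_oracle (tt i) (nfst e) (nsnd e)) (nfst e) cg x)
          (fun _ x => npair (nfst (nsnd (nfst x))) (nsnd x))).
        * apply (ucomp_beval (fun i e => prefix_oracle (tt i) (nfst e) (nsnd e))
            (fun _ e => nfst e)); auto using ucomp_fst, ucomp_id.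
          apply ucomp_prefix_oracle; auto using ucomp_fst, ucomp_snd, ucomp_id.
        * apply ucomp_pair; auto using ucomp_fst, ucomp_snd, ucomp_id.
        * apply ucomp_add; auto using ucomp_const, ucomp_fst, ucomp_id.
      + apply udec_const.
      + apply Hnear; auto 6 using ucomp_fst, ucomp_snd, ucomp_id. }
  destruct Htest as [c Hc].
  exists (Comp Snd (Mu c)). intros u t r y Hut Hur [a0 Ha0] Hall.
  assert (Hc' : forall k v, eval u c (npair k v) (test t r k v)).
  { intros k v. specialize (Hc (exist _ (u, t, r) (conj Hut Hur)) (npair k v)).
    now rewrite nfst_npair, nsnd_npair in Hc. }
  assert (test_spec : forall k v, test t r k v = 0%nat <->
    forall a, accepts t r k (nfst v) (nsnd v) (prefix a (nfst v)) = true).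
  { intros k v. unfold test. split.
    - intros H a. apply NNPP; intros E.
      assert (B : bex (2 ^ nfst v) (fun w =>
        negb (accepts t r k (nfst v) (nsnd v) w)) = true).
      { apply bex_spec. exists (prefix a (nfst v)). split; [apply prefix_lt|].
        now apply negb_true_iff, not_true_is_false. }
      rewrite B in H. discriminate.
    - intros H. match goal with |- Nat.b2n ?b = _ => destruct b eqn:B end; [|reflexivity].
      apply bex_spec in B. destruct B as (w & Hw & B).
      rewrite <- (prefix_testbit w (nfst v)) in B by auto.
      now rewrite H in B. }
  (* The candidate is entry [k + 5] of one name [q0] of [y]. If no length worked, compactness would
     give a point all of whose prefixes are rejected, which is impossible both inside and outside
     the closed set. *)
  assert (Hfound : forall k, exists v, test t r k v = 0%nat).
  { intros k. destruct (Hall a0 Ha0) as (q0 & _ & Hq0).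
    apply NNPP; intros Hno.
    destruct (weak_konig (fun N w => accepts t r k N (q0 (k + 5)%nat) w <> true))
      as [a Ha].
    - intros N. apply NNPP; intros Hn. apply Hno.
      exists (npair N (q0 (k + 5)%nat)). apply test_spec.
      rewrite nfst_npair, nsnd_npair. intros a. apply NNPP; eauto.
    - intros N M a HNM Hbad Hacc. apply Hbad. unfold accepts in *.
      apply orb_true_iff in Hacc. apply orb_true_iff. destruct Hacc as [H|H].
      + left. now apply (killed_mono r a N).
      + right. destruct (beval _ N _ _) as [|j] eqn:E in H; [discriminate|].
        erewrite beval_mono; [exact H| |exact HNM|exact E].
        intros l v. now apply prefix_oracle_mono.
    - destruct (classic (avoids r a)) as [Hav|Hav].
      + destruct (Hall a Hav) as (q & Hq & Hqy).
        destruct (beval_complete (bpair t (cantor_name a))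
          (fun N => prefix_oracle t N (prefix a N)) cg (k + 5) (q (k + 5)%nat))
          as [N HN].
        * intros N N' l v HN. now apply prefix_oracle_mono.
        * apply prefix_oracle_limit.
        * apply Hq.
        * apply (Ha N). unfold accepts. rewrite HN. apply orb_true_iff. right.
          apply near_complete.
          (* Both approximations are within [2^-(k+5)] of [y], hence within twice that of each
             other. *)
          pose proof (cauchy_rep_dist_le Y q y (k + 5) Hqy).
          pose proof (cauchy_rep_dist_le Y q0 y (k + 5) Hq0).
          pose proof (dist_tri Y (alpha Y (q (k + 5)%nat))
            (alpha Y (q0 (k + 5)%nat)) y) as T.
          rewrite (dist_sym Y y (alpha Y (q0 _))) in T. lra.
      + destruct (killed_complete r a Hav) as [N HN].
        apply (Ha N). unfold accepts. now rewrite HN. }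
  destruct (choice (fun k v => eval u (Mu c) k v /\ test t r k v = 0%nat)) as [vv Hvv].
  { intros k. destruct (Hfound k) as [v Hv]. now apply (eval_mu_least u c (test t r) k v). }
  exists (fun k => nsnd (vv k)). split.
  - intros k. exists (vv k). split; [apply Hvv|reflexivity].
  - apply cauchy_rep_of_dist_lt. intros k.
    (* The prefix of a true member [a0] cannot be refuted, so it was accepted because of a correct
       output of [cg]. *)
    destruct (Hvv k) as [_ H]. rewrite test_spec in H. specialize (H a0).
    unfold accepts in H. apply orb_true_iff in H. destruct H as [H|H].
    { now apply killed_sound in H. }
    destruct (beval _ _ _ _) as [|j] eqn:E in H; [discriminate|].
    destruct (Hall a0 Ha0) as (q & Hq & Hqy).
    apply (beval_sound (bpair t (cantor_name a0))) in E;
      [|intros l v; apply prefix_oracle_name].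
    rewrite <- (eval_single _ _ _ _ _ (Hq (k + 5)%nat) E) in H.
    apply near_sound in H.
    pose proof (cauchy_rep_dist_le Y q y (k + 5) Hqy).
    pose proof (dist_tri Y (alpha Y (nsnd (vv k))) y (alpha Y (q (k + 5)%nat))) as T.
    rewrite (dist_sym Y _ (alpha Y (q _))) in T.
    (* The candidate is less than [5 + 1 = 6] units [2^-(k+5)] away from [y], and 16 units are
       allowed. *)
    assert (Hp : (/ 2) ^ S k = 16 * (/ 2) ^ (k + 5))
      by (rewrite pow_add; simpl; field).
    pose proof (half_pow_pos (k + 5)). lra.
Qed.

(** * Weihrauch reductions *)

Lemma computable_single (F : mfun baire baire) : computable F -> single_valued F.
Proof.
  intros [c Hc] p q q' Hq Hq'. apply functional_extensionality. intros n.
  rewrite Hc in Hq, Hq'. exact (eval_single _ _ _ _ _ (Hq n) (Hq' n)).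
Qed.

Lemma sandwich_single (H K G : mfun baire baire) :
  single_valued H -> single_valued K -> single_valued G ->
  single_valued (sandwich H K G).
Proof.
  intros HH HK HG p q q' (r & s & Hr & Hs & Hq) (r' & s' & Hr' & Hs' & Hq').
  rewrite (HK _ _ _ Hr' Hr) in Hs'. rewrite (HG _ _ _ Hs' Hs) in Hq'.
  exact (HH _ _ _ Hq Hq').
Qed.

(** The choice depends on the name and not just on the set, so it can be prescribed at one name
    while the others keep theirs. *)
Definition selection (sel : baire -> nat -> bool) : Prop :=
  forall r, (exists a, avoids r a) -> avoids r (sel r).

Definition selection_realizer (sel : baire -> nat -> bool) : mfun baire baire :=
  fun r s => s = cantor_name (sel r) /\ avoids r (sel r).

Lemma selection_ex : exists sel, selection sel.
Proof.
  apply (choice (fun r b => (exists a, avoids r a) -> avoids r b)). intros r.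
  destruct (classic (exists a, avoids r a)) as [[a Ha]|H].
  - exists a; auto.
  - exists (fun _ => false); tauto.
Qed.

Lemma selection_through (r : baire) (a : nat -> bool) :
  avoids r a -> exists sel, selection sel /\ sel r = a.
Proof.
  intros Ha. destruct selection_ex as [sel Hsel].
  exists (fun p => if excluded_middle_informative (p = r) then a else sel p).
  split.
  - intros p Hp. destruct (excluded_middle_informative (p = r)) as [->|]; auto.
  - destruct (excluded_middle_informative (r = r)); tauto.
Qed.

Lemma selection_realizes (sel : baire -> nat -> bool) :
  selection sel -> realizes (selection_realizer sel) (closed_choice cantor_space).
Proof.
  intros Hsel. split.
  - intros p s s' [-> _] [-> _]; reflexivity.
  - intros p A HpA [b Hb].
    assert (Hs : avoids p (sel p)) by (apply Hsel; exists b; now apply HpA).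
    exists (cantor_name (sel p)), (sel p).
    split; [now split|]. split; [apply cantor_name_rep|now apply HpA].
Qed.

(* A reduction must work for every realizer: one that is undefined off the
   non-empty closed sets forces [K t] to name such a set, and one that sends
   [K t] to a chosen point forces [H] to succeed on every point of that set. *)
Lemma reduction_to_closed_choice {Z W : RepSpace} (g : mfun Z W)
    (H K : mfun baire baire) (t : baire) (z : Z) :
  computable K ->
  (forall G, realizes G (closed_choice cantor_space) ->
     realizes (sandwich H K G) g) ->
  rep Z t z -> mdom g z ->
  exists r, K t r /\ (exists a, avoids r a) /\
    forall a, avoids r a -> exists q y,
      H (bpair t (cantor_name a)) q /\ rep W q y /\ g z y.
Proof.
  intros HK Hred Htz Hz.
  destruct selection_ex as [sel0 Hsel0].
  destruct (proj2 (Hred _ (selection_realizes _ Hsel0)) t z Htz Hz)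
    as (_ & _ & (r & s & HKr & [_ Hs] & _) & _).
  exists r. split; [auto|]. split; [eauto|]. intros a Ha.
  destruct (selection_through r a Ha) as (sel & Hsel & <-).
  destruct (proj2 (Hred _ (selection_realizes _ Hsel)) t z Htz Hz)
    as (q & y & (r' & s' & HKr' & [-> _] & Hq) & Hqy & Hgy).
  rewrite (computable_single K HK _ _ _ HKr' HKr) in Hq. eauto.
Qed.

Theorem theorem8p14 (X : RepSpace) (Y : CompMetricSpace) (n : nat)
    (f : mfun X (cauchy_space Y)) :
  single_valued f -> weakly_succ_computable n f -> succ_computable n f.
Proof.
  intros Hf (Z & g & h & Hfgh & (Hg & Kg & CHg & CKg & Hgred) &
             (Hh & Kh & CHh & CKh & Hhred)).
  pose proof CHg as [cHg EHg]. pose proof CKg as [cKg EKg].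
  pose proof CHh as [cHh EHh].
  (* The substituted program computes [Kg t] directly from the oracle from which [cHh] computes
     [t]. *)
  destruct (exhaustive_search Y cHh (oracle_subst cKg cHh) cHg) as [d Hd].
  set (H := fun p q : baire => forall k, eval p d k (q k)).
  assert (CH : computable H) by (exists d; reflexivity).
  (* The reduction of [h] keeps its inner function [Kh]; the search becomes the outer function. *)
  exists H, Kh. split; [auto|]. split; [auto|]. intros G HG. split.
  { apply sandwich_single; auto using computable_single. apply HG. }
  intros p x Hpx [y Hfy].
  (* The realizer of [h] may produce a point [z] other than [z0]; [Hdom] ensures that [g] is defined
     there too. *)
  pose proof (proj1 (Hfgh x y) Hfy) as [Hdom (z0 & Hz0 & _)].
  destruct (proj2 (Hhred G HG) p x Hpx (ex_intro _ z0 Hz0))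
    as (t & z & (r0 & s & HK & HGs & Ht) & Htz & Hxz).
  destruct (reduction_to_closed_choice g Hg Kg t z CKg Hgred Htz (Hdom z Hxz))
    as (r & Hr & Hne & Hall).
  rewrite EHh in Ht. rewrite EKg in Hr.
  destruct (Hd (bpair p s) t r y) as (q & Hq & Hqy); auto.
  - intros k. now apply (eval_oracle_subst (bpair p s) t cKg cHh Ht).
  - intros a Ha. destruct (Hall a Ha) as (q & y' & Hq & Hqy & Hgy).
    exists q. split; [now apply EHg|].
    replace y with y'; [exact Hqy|].
    (* Every value of [g] at [z] is a value of [f] at [x], so all members of the closed set lead to
       the same [y]. *)
    apply (Hf x); [apply Hfgh; split; eauto|exact Hfy].
  - exists q, y. split; [|now split]. exists r0, s; auto.
Qed.
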